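(* Let $n\ge3$, $\zeta=2\pi/n$, $m\in\big([1,n/4)\cup(n/4,n/2]\big)\cap\mathbb{N}$, $a>0$, and let $V$ be smooth with $V''(a^2)\neq0$. Define $\sigma_m=\operatorname{sgn}(V''(a^2))$ if $m\in[1,n/4)$ and $\sigma_m=-\operatorname{sgn}(V''(a^2))$ if $m\in(n/4,n/2]$. If $\sigma_m<0$, or $\sigma_m>0$ and $\phi_1(a)<1$, then the relative equilibrium $q_j(t)=ae^{i\omega t}e^{ijm\zeta}$ (equivalently the equilibrium $\mathbf{a}_m$ of $\mathcal{J}\dot u=\nabla H(u)$) is linearly stable, i.e. $\mathcal{J}D^2H(\mathbf{a}_m)$ has only purely imaginary eigenvalues.
   Context: Lattice: $i\dot q_j=V'(|q_j|^2)q_j+(q_{j+1}-q_j)+(q_{j-1}-q_j)$, $q_j\in\mathbb{C}$, $q_{j+n}=q_j$, with $\omega=4\sin^2(m\zeta/2)-V'(a^2)$. Identify $\mathbb{C}\cong\mathbb{R}^2$, $J=\begin{pmatrix}0&-1\\1&0\end{pmatrix}$, $\mathcal{J}=\mathrm{diag}(J,\dots,J)$, $H(u)=\frac12\sum_{j=1}^n\{V(|u_j|^2)+\omega|u_j|^2-|u_{j+1}-u_j|^2\}$ for $u\in(\mathbb{R}^2)^n$ (indices mod $n$), so that $q_j=e^{i\omega t}u_j$ turns the lattice into $\mathcal{J}\dot u=\nabla H(u)$. $\mathbf{a}_m=(a_1,\dots,a_n)$ with $a_j=ae^{jm\zeta J}e_1$. Also $\alpha_1=4\cos(m\zeta)\sin^2(\zeta/2)$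 and $\phi_1(a)=\frac{2a^2}{\alpha_1}V''(a^2)$. *)

(* Defs.v *)
From Stdlib Require Import Reals.
From Coquelicot Require Import Coquelicot.
From mathcomp Require Import all_boot all_algebra.
From mathcomp Require Import Rstruct complex.

Set Implicit Arguments.
Unset Strict Implicit.
Unset Printing Implicit Defensive.

Local Open Scope R_scope.

Definition sgn (x : R) : R :=
  if Rlt_dec x 0 then -1 else if Rlt_dec 0 x then 1 else 0.

Definition zeta (n : nat) : R := 2 * PI / INR n.

Definition omega (V : R -> R) (n m : nat) (a : R) : R :=
  4 * (sin (INR m * zeta n / 2)) ^ 2 - Derive V (a ^ 2).

(* A point u in (R^2)^n is encoded by its coordinates x : nat -> R,
   u_j = (x (2j), x (2j+1)) for j = 0..n-1, indices of u taken mod n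
   (u_0 plays the role of the paper's u_n). *)
Definition ucoord (n : nat) (x : nat -> R) (j c : nat) : R :=
  x (2 * (j mod n) + c)%nat.

Definition normsq (n : nat) (x : nat -> R) (j : nat) : R :=
  ucoord n x j 0 ^ 2 + ucoord n x j 1 ^ 2.

Definition diffsq (n : nat) (x : nat -> R) (j : nat) : R :=
  (ucoord n x (j + 1) 0 - ucoord n x j 0) ^ 2
  + (ucoord n x (j + 1) 1 - ucoord n x j 1) ^ 2.

Definition Ham (V : R -> R) (n m : nat) (a : R) (x : nat -> R) : R :=
  / 2 * (\sum_(j < n) (V (normsq n x j) + omega V n m a * normsq n x j
                       - diffsq n x j))%R.

(* the equilibrium a_m : a_j = a e^{j m zeta J} e_1 = a (cos (j m zeta), sin (j m zeta)) *)
Definition am (n m : nat) (a : R) : nat -> R :=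
  fun i => if odd i then a * sin (INR (i./2) * INR m * zeta n)
           else a * cos (INR (i./2) * INR m * zeta n).

Definition hess (f : (nat -> R) -> R) (x0 : nat -> R) (k l : nat) : R :=
  Derive (fun t =>
    Derive (fun s =>
      f (fun i => x0 i + s * (if Nat.eqb i k then 1 else 0)
                       + t * (if Nat.eqb i l then 1 else 0))) 0) 0.

Definition hess_mx (n : nat) (f : (nat -> R) -> R) (x0 : nat -> R) : 'M[R]_(2 * n) :=
  \matrix_(k, l) hess f x0 k l.

(* calJ = diag(J, ..., J), J = [[0, -1], [1, 0]] *)
Definition calJ (n : nat) : 'M[R]_(2 * n) :=
  \matrix_(k, l)
    (if ~~ odd k && (l == k.+1 :> nat) then -1
     else if odd k && (k == l.+1 :> nat) then 1 else 0).

Definition only_imaginary_eigenvalues (N : nat) (M : 'M[R]_N) : Prop :=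
  forall lam : R[i], eigenvalue (map_mx (fun x : R => x%:C%C) M) lam ->
    complex.Re lam = 0.

Definition alpha1 (n m : nat) : R := 4 * cos (INR m * zeta n) * (sin (zeta n / 2)) ^ 2.

Definition phi1 (V : R -> R) (n m : nat) (a : R) : R :=
  2 * a ^ 2 / alpha1 n m * Derive_n V 2 (a ^ 2).

Definition sigma_m (V : R -> R) (n m : nat) (a : R) : R :=
  if (4 * m < n)%nat then sgn (Derive_n V 2 (a ^ 2))
  else - sgn (Derive_n V 2 (a ^ 2)).

(* Main.v *)
(* Let v be a left eigenvector of J D^2H for lam and put w = v J. Pairing
   w D^2H = lam v with the plane waves eta^j (1, tau), where tau = +-i and
   eta^n = 1, only involves the amplitudes P_tau(eta) = sum_j eta^j (w_j0 + tau w_j1):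
   the term 2 V''(a^2) a_j a_j^T of D^2H couples P_tau(eta) to
   P_(-tau)(eta e^(2 tau m zeta)) and to nothing else. Hence for each k the
   amplitudes at eta = e^(i (k -+ m) zeta) solve a 2x2 system with parameter
   i lam, whose determinant is a real quadratic in i lam with discriminant
   4 alpha_k (alpha_k - 2 a^2 V''(a^2)), alpha_k = 4 cos(m zeta) sin(k zeta / 2)^2.
   The hypotheses for k = 1 make it nonnegative for all k, since
   |alpha_1| <= |alpha_k| and all alpha_k, 0 < k < n, have the same sign. So i lam is
   real as soon as one amplitude is nonzero, and they cannot all vanish: for
   fixed tau they are the values at n distinct points of a polynomial of degree < n. *)
Require Import Defs.
From Stdlib Require Import Reals Lra.
From Coquelicot Require Import Coquelicot.
From mathcomp Require Import all_boot all_algebra.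
From mathcomp Require Import Rstruct complex.
Import GRing.Theory Num.Theory.

Local Open Scope R_scope.

(** * The Hessian of the Hamiltonian as a sum over sites *)

Lemma is_derive_bigsum (n : nat) (f : nat -> R -> R) (df : nat -> R) (x : R) :
  (forall j, is_derive (f j) x (df j)) ->
  is_derive (fun y => (\sum_(j < n) f j y)%R) x (\sum_(j < n) df j)%R.
Proof.
move=> hf; elim: n => [|n IHn].
  rewrite big_ord0; apply: (is_derive_ext (fun=> 0)) => [t|]; first by rewrite big_ord0.
  exact: is_derive_const.
rewrite big_ord_recr /=.
apply: (is_derive_ext (fun y => (\sum_(j < n) f j y)%R + f n y)) => [t|].
  by rewrite big_ord_recr.
exact: is_derive_plus IHn (hf n).
Qed.

Definition unit_vec (k i : nat) : R := if Nat.eqb i k then 1 else 0.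

Definition pairing (n : nat) (x y : nat -> R) (j : nat) : R :=
  ucoord n x j 0 * ucoord n y j 0 + ucoord n x j 1 * ucoord n y j 1.

Definition diff_pairing (n : nat) (x y : nat -> R) (j : nat) : R :=
  (ucoord n x (j + 1) 0 - ucoord n x j 0) * (ucoord n y (j + 1) 0 - ucoord n y j 0)
  + (ucoord n x (j + 1) 1 - ucoord n x j 1) * (ucoord n y (j + 1) 1 - ucoord n y j 1).

(* The j-th summand of the Hessian form of [Ham] at x, evaluated at (y, z). *)
Definition hess_density (V : R -> R) (n m : nat) (a : R) (x y z : nat -> R) (j : nat) : R :=
  2 * Derive (Derive V) (normsq n x j) * pairing n x y j * pairing n x z j
  + (Derive V (normsq n x j) + omega V n m a) * pairing n y z j
  - diff_pairing n y z j.

Lemma hess_Ham (V : R -> R) (n m : nat) (a : R) (x : nat -> R) (k l : nat) :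
  (forall y, ex_derive V y) -> (forall y, ex_derive (Derive V) y) ->
  hess (Ham V n m a) x k l =
  (\sum_(j < n) hess_density V n m a x (unit_vec k) (unit_vec l) j)%R.
Proof.
move=> dV ddV; rewrite /hess.
pose z s t := fun i => x i + s * unit_vec k i + t * unit_vec l i.
(* Half the [s]-derivative at [s = 0] of the [j]-th summand of [Ham]: the prefactor 1/2 of [Ham]
   cancels the 2 coming from the squares. *)
pose D t j := (Derive V (normsq n (z 0 t) j) + omega V n m a)
              * pairing n (z 0 t) (unit_vec k) j - diff_pairing n (z 0 t) (unit_vec k) j.
have d1 t : Derive (fun s => Ham V n m a (z s t)) 0 = (\sum_(j < n) D t j)%R.
  apply: is_derive_unique; rewrite /Ham.
  pose D2 j := 2 * D t j.
  have -> : (\sum_(j < n) D t j)%R = / 2 * (\sum_(j < n) D2 j)%R.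
    rewrite (_ : / 2 * _ = (/ 2 * \sum_(j < n) D2 j)%R) //.
    rewrite GRing.mulr_sumr; apply: eq_bigr => j _.
    change (D t j = / 2 * (2 * D t j)); field.
  apply: is_derive_scal.
  apply: (is_derive_bigsum n (fun j s => V (normsq n (z s t) j)
    + omega V n m a * normsq n (z s t) j - diffsq n (z s t) j) D2) => j.
  rewrite /D2 /D /normsq /diffsq /diff_pairing /pairing /ucoord /z; auto_derive => //.
  change (Derive (fun x => V x)) with (Derive V); cbn [pow]; ring.
rewrite (Derive_ext _ _ _ d1); apply: is_derive_unique.
apply: (is_derive_bigsum n (fun j t => D t j)) => j.
rewrite /D /hess_density /normsq /diff_pairing /pairing /ucoord /z; auto_derive => //.
change (Derive (fun x => V x)) with (Derive V).
change (Derive (fun x => Derive V x)) with (Derive (Derive V)).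
rewrite !Rmult_0_l !Rplus_0_r; cbn [pow]; ring.
Qed.

(** * Trigonometric bounds and the sign of the discriminant *)

Lemma sin_ge_ends (h x : R) : 0 < h -> h <= x -> x <= PI - h -> sin h <= sin x.
Proof.
move=> h0 hx xh.
have [x1|x1] := Rle_lt_dec x (PI / 2); first by apply: sin_incr_1; lra.
rewrite -(sin_PI_x x); apply: sin_incr_1; lra.
Qed.

(** The angle k zeta / 2 = k PI / n lies in [PI/n, PI - PI/n], where sine is smallest at the two
    ends. This is the source of |alpha_1| <= |alpha_k|. *)
Lemma sin_half_zeta (n k : nat) : (3 <= n)%nat -> (0 < k < n)%nat ->
  0 < sin (zeta n / 2) <= sin (INR k * zeta n / 2).
Proof.
move=> n3 /andP[k0 kn].
have n3R : 3 <= INR n by have := le_INR 3 n (elimT leP n3); rewrite /=; lra.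
have k1R : 1 <= INR k by have := le_INR 1 k (elimT leP k0).
have knR : INR k + 1 <= INR n by rewrite -S_INR; apply/le_INR/leP.
have -> : zeta n / 2 = PI / INR n by rewrite /zeta; field; lra.
have -> : INR k * zeta n / 2 = INR k * (PI / INR n) by rewrite /zeta; field; lra.
have pi0 := PI_RGT_0.
have nh : INR n * (PI / INR n) = PI by field; lra.
have h0 : 0 < PI / INR n by apply: Rdiv_lt_0_compat; lra.
move: (PI / INR n) nh h0 => h nh h0.
split; first by apply: sin_gt_0; nra.
apply: sin_ge_ends; nra.
Qed.

Lemma INR_mul_zeta (n : nat) : (0 < n)%nat -> INR n * zeta n = 2 * PI.
Proof.
by move=> /ltP n0; rewrite /zeta; field; have := lt_0_INR n n0; lra.
Qed.

Lemma cos_zeta_pos (n m : nat) : (0 < n)%nat -> (4 * m < n)%nat -> 0 < cos (INR m * zeta n).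
Proof.
move=> n0 mn.
have n0R : 0 < INR n by apply/lt_0_INR/ltP.
have mnR : 4 * INR m < INR n.
  by have := lt_INR _ _ (elimT ltP mn); rewrite mult_INR /=; lra.
have m0 := pos_INR m; have pi0 := PI_RGT_0.
have nz := INR_mul_zeta n n0.
have z0 : 0 < zeta n by apply: Rdiv_lt_0_compat; lra.
apply: cos_gt_0; nra.
Qed.

Lemma cos_zeta_neg (n m : nat) : (n < 4 * m)%nat -> (2 * m <= n)%nat ->
  cos (INR m * zeta n) < 0.
Proof.
move=> nm mn.
have nmR : INR n < 4 * INR m.
  by have := lt_INR _ _ (elimT ltP nm); rewrite mult_INR /=; lra.
have mnR : 2 * INR m <= INR n.
  by have := le_INR _ _ (elimT leP mn); rewrite mult_INR /=; lra.
have pi0 := PI_RGT_0.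
have n0R : 0 < INR n by have := pos_INR n; lra.
have n0 : (0 < n)%nat by apply/ltP/INR_lt.
have nz := INR_mul_zeta n n0.
have z0 : 0 < zeta n by apply: Rdiv_lt_0_compat; lra.
apply: cos_lt_0; nra.
Qed.

(** Put b = V''(a^2) and let k >= 1. If cos(m zeta) > 0, then alpha_k >= alpha_1 > 0 and the
    hypotheses give b <= 0 or 2 a^2 b <= alpha_1, so both factors are nonnegative. If cos(m zeta) <
    0, every inequality reverses and both factors are nonpositive. For k = 0 the product
    vanishes. *)
Lemma stability_condition (V : R -> R) (n m : nat) (a : R) :
  (3 <= n)%nat -> ((4 * m < n)%nat \/ ((n < 4 * m)%nat /\ (2 * m <= n)%nat)) -> 0 < a ->
  (sigma_m V n m a < 0 \/ (0 < sigma_m V n m a /\ phi1 V n m a < 1)) ->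
  forall k : nat, (k < n)%nat ->
  let alpha := 4 * cos (INR m * zeta n) * (sin (INR k * zeta n / 2)) ^ 2 in
  0 <= alpha * (alpha - 2 * a ^ 2 * Derive_n V 2 (a ^ 2)).
Proof.
move=> n3 hm a0 hs k kn alpha.
have [k0|k0] := posnP k.
  by rewrite /alpha k0 /= Rmult_0_l Rdiv_0_l sin_0; lra.
have [s0 s1] : _ /\ _ := sin_half_zeta n k n3 (introT andP (conj k0 kn)).
have ss : 0 < sin (zeta n / 2) ^ 2 <= sin (INR k * zeta n / 2) ^ 2 by nra.
move: hs; rewrite /phi1 /sigma_m /sgn /alpha1 {}/alpha.
move: (sin (zeta n / 2) ^ 2) (sin (INR k * zeta n / 2) ^ 2) ss => p q pq.
set b := Derive_n V 2 _ => hs.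
have a2 : 0 < a ^ 2 by nra.
case: hm hs => [mn|[mn1 mn2]].
  have := cos_zeta_pos n m (leq_trans _ n3) mn; move: (cos _) => c /(_ isT) c0.
  rewrite mn => hs.
  have hb : 2 * a ^ 2 * b <= 4 * c * p \/ b <= 0.
    case: hs => [|[_ hp]]; first by case: Rlt_dec => ?; [|case: Rlt_dec => ?] => /= ?; right; lra.
    left.
    have cp : 0 < 4 * c * p by nra.
    (* The first factor is [phi1], which is below 1; the second is alpha_1. *)
    have -> : 2 * a ^ 2 * b = (2 * a ^ 2 / (4 * c * p) * b) * (4 * c * p) by field; split; lra.
    nra.
  have cq : 0 < c * p <= c * q by nra.
  have h1 : 0 <= 4 * c * q by nra.
  have h2 : 2 * a ^ 2 * b <= 4 * c * q by case: hb => hb; nra.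
  nra.
have := cos_zeta_neg n m mn1 mn2; move: (cos _) => c c0.
rewrite ltnNge (ltnW mn1) /= => hs.
have hb : 4 * c * p <= 2 * a ^ 2 * b \/ 0 <= b.
  case: hs => [|[_ hp]].
    by case: Rlt_dec => ?; [|case: Rlt_dec => ?] => /= ?; right; lra.
  left.
  (* Here alpha_1 < 0, so [phi1] below 1 becomes a lower bound on 2 a^2 b. *)
  have cp : 0 < - (4 * c * p) by nra.
  have -> : 2 * a ^ 2 * b = (2 * a ^ 2 / (4 * c * p) * b) * (4 * c * p) by field; split; lra.
  nra.
have cq : 0 < - c * p <= - c * q by nra.
have h1 : 4 * c * q <= 0 by nra.
have h2 : 4 * c * q <= 2 * a ^ 2 * b by case: hb => hb; nra.
nra.
Qed.

Lemma cos_zeta_neq1 (n k : nat) : (3 <= n)%nat -> (0 < k < n)%nat ->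
  cos (INR k * zeta n) <> 1.
Proof.
move=> n3 kn; have [s0 s1] := sin_half_zeta n k n3 kn.
have -> : INR k * zeta n = 2 * (INR k * zeta n / 2) by field.
rewrite cos_2a_sin; nra.
Qed.

(** For s = k zeta and t = m zeta the right side is -2 alpha_k; the left side is the sum [x + y] of
    the two diagonal terms of the 2x2 system. *)
Lemma cos_zeta_sum (s t : R) :
  (2 * cos (s - t) - 2 * cos t) + (2 * cos (s + t) - 2 * cos t)
  = - 2 * (4 * cos t * sin (s / 2) ^ 2).
Proof.
rewrite cos_plus cos_minus.
have -> : cos s = 1 - 2 * sin (s / 2) * sin (s / 2).
  by rewrite -cos_2a_sin; congr cos; field.
ring.
Qed.

(** If r <> 0, the last equation forces s = (y - x)/2, which makes both factors equal to alpha + (x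
    + y)/2. The other equation then reads (x + y)(x + y + 4 alpha)/4 + r^2 = 0, against the sign
    hypothesis. Here [alpha] stands for a^2 V''(a^2), not for alpha_k. *)
Lemma real_quadratic (alpha x y r s : R) :
  0 <= (x + y) * (x + y + 4 * alpha) ->
  (alpha + x + s) * (alpha + y - s) + r ^ 2 - alpha ^ 2 = 0 ->
  r * ((alpha + x + s) - (alpha + y - s)) = 0 -> r = 0.
Proof.
move=> disc hre him; case: (Req_dec r 0) => // r0.
have hs : s = (y - x) / 2 by have := Rmult_integral _ _ him; case=> //; lra.
have r2 : 0 < r ^ 2 by nra.
move: hre; rewrite hs => hre; nra.
Qed.

Lemma discriminant_ge0 (V : R -> R) (n m : nat) (a : R) (k : nat) :
  (3 <= n)%nat -> ((4 * m < n)%nat \/ ((n < 4 * m)%nat /\ (2 * m <= n)%nat)) -> 0 < a ->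
  (sigma_m V n m a < 0 \/ (0 < sigma_m V n m a /\ phi1 V n m a < 1)) -> (k < n)%nat ->
  let s := INR k * zeta n in
  let t := INR m * zeta n in
  let xy := (2 * cos (s - t) - 2 * cos t) + (2 * cos (s + t) - 2 * cos t) in
  0 <= xy * (xy + 4 * (a ^ 2 * Derive_n V 2 (a ^ 2))).
Proof.
move=> n3 hm a0 hs kn /=; rewrite cos_zeta_sum.
have := stability_condition V n m a n3 hm a0 hs k kn => /=.
set A := 4 * _ * _; nra.
Qed.

From mathcomp Require Import ring.
Local Open Scope ring_scope.

(** * Pairing the Hessian density with complex vectors *)

Lemma sum_unit_vec (N i : nat) (w : nat -> R[i]) : (i < N)%N ->
  \sum_(k < N) w k * (unit_vec k i)%:C%C = w i.
Proof.
move=> iN; rewrite (bigD1 (Ordinal iN)) //= /unit_vec PeanoNat.Nat.eqb_refl mulr1.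
rewrite big1 ?addr0 // => k /eqP neq_ki.
case: PeanoNat.Nat.eqb_spec => [eq_ik|_]; last by rewrite mulr0.
by case: neq_ki; apply: val_inj.
Qed.

Lemma sum_mul_complex (N : nat) (w f : nat -> R[i]) (c : R) (x y : nat -> R) :
  \sum_(k < N) \sum_(l < N) w k * (c * x k * y l)%:C%C * f l
  = c%:C%C * (\sum_(k < N) w k * (x k)%:C%C) * (\sum_(l < N) f l * (y l)%:C%C).
Proof.
rewrite -mulrA big_distrl /= big_distrr /=; apply: eq_bigr => k _.
rewrite big_distrr /= big_distrr /=; apply: eq_bigr => l _.
rewrite !rmorphM /=; ring.
Qed.

Lemma lt_double_mod (n j c : nat) : (0 < n)%N -> (c < 2)%N ->
  (2 * Nat.modulo j n + c < 2 * n)%N.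
Proof.
move=> n0 c2; apply: (@leq_trans (2 * (Nat.modulo j n).+1)).
  by rewrite mulnS addnC ltn_add2r.
rewrite leq_mul2l /=; apply/ltP/PeanoNat.Nat.mod_upper_bound.
by move=> n1; rewrite n1 in n0.
Qed.

(** The density is a combination of five rank-one forms: one along u_j, two coordinate squares and
    two squared differences. By [sum_mul_complex] each double sum factors. *)
Lemma hess_density_sum (V : R -> R) (n m : nat) (a : R) (x : nat -> R) (w f : nat -> R[i])
    (j : nat) : (0 < n)%N ->
  let u c := (ucoord n x j c)%:C%C in
  let wj c := w (2 * Nat.modulo j n + c)%N in
  let fj c := f (2 * Nat.modulo j n + c)%N in
  let dw c := w (2 * Nat.modulo (j + 1) n + c)%N - wj c in
  let df c := f (2 * Nat.modulo (j + 1) n + c)%N - fj c in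
  \sum_(k < 2 * n) \sum_(l < 2 * n)
    w k * (hess_density V n m a x (unit_vec k) (unit_vec l) j)%:C%C * f l
  = (2 * Derive (Derive V) (normsq n x j))%:C%C
      * (u 0%N * wj 0%N + u 1%N * wj 1%N) * (u 0%N * fj 0%N + u 1%N * fj 1%N)
    + (Derive V (normsq n x j) + omega V n m a)%:C%C * (wj 0%N * fj 0%N + wj 1%N * fj 1%N)
    - (dw 0%N * df 0%N + dw 1%N * df 1%N).
Proof.
move=> n0 /=.
set A := 2 * _; set B := _ + omega _ _ _ _; set u := ucoord n x j.
(* The coordinate functional of component [c] at site [i]; [g] is the inner product with u_j and [d]
   the forward difference at site [j]. *)
pose e i c (k : nat) : R := unit_vec k (2 * Nat.modulo i n + c)%N.
pose g k := u 0%N * e j 0%N k + u 1%N * e j 1%N k.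
pose d c k := e (j + 1)%N c k - e j c k.
have -> : \sum_(k < 2 * n) \sum_(l < 2 * n)
    w k * (hess_density V n m a x (unit_vec k) (unit_vec l) j)%:C%C * f l =
  \sum_(k < 2 * n) \sum_(l < 2 * n)
   (w k * ((A * g k) * g l)%:C%C * f l
    + (w k * ((B * e j 0%N k) * e j 0%N l)%:C%C * f l
    + w k * ((B * e j 1%N k) * e j 1%N l)%:C%C * f l)
    - (w k * (1 * d 0%N k * d 0%N l)%:C%C * f l
    + w k * (1 * d 1%N k * d 1%N l)%:C%C * f l)).
  apply: eq_bigr => k _; apply: eq_bigr => l _.
  have -> : hess_density V n m a x (unit_vec k) (unit_vec l) j =
    (A * g k) * g l + ((B * e j 0%N k) * e j 0%N l + (B * e j 1%N k) * e j 1%N l)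
    - (1 * d 0%N k * d 0%N l + 1 * d 1%N k * d 1%N l).
    rewrite /hess_density /diff_pairing /pairing /g /d /e /A /B /u /ucoord.
    rewrite !RplusE !RminusE !RmultE IZRposE INRE [nat_of_pos 2]/=.
    ring.
  rewrite rmorphB !rmorphD /=; ring.
under eq_bigr => k _ do rewrite sumrB 2!big_split [X in _ - X]big_split /=.
rewrite sumrB 2!big_split [X in _ - X]big_split /=.
rewrite !sum_mul_complex.
have S i c (h : nat -> R[i]) : (c < 2)%N -> \sum_(k < 2 * n) h k * (e i c k)%:C%C
    = h (2 * Nat.modulo i n + c)%N.
  by move=> c2; rewrite sum_unit_vec // lt_double_mod.
have Sg (h : nat -> R[i]) : \sum_(k < 2 * n) h k * (g k)%:C%C
   = (u 0%N)%:C%C * h (2 * Nat.modulo j n + 0)%N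
   + (u 1%N)%:C%C * h (2 * Nat.modulo j n + 1)%N.
  rewrite -!S // !big_distrr -big_split /=; apply: eq_bigr => k _.
  rewrite rmorphD !rmorphM /=; ring.
have Sd c (h : nat -> R[i]) : (c < 2)%N -> \sum_(k < 2 * n) h k * (d c k)%:C%C
    = h (2 * Nat.modulo (j + 1) n + c)%N - h (2 * Nat.modulo j n + c)%N.
  move=> c2; rewrite -!S // -sumrB; apply: eq_bigr => k _.
  rewrite rmorphB /=; ring.
rewrite !Sg !Sd // !S // rmorph1; ring.
Qed.

(** * Complex exponentials *)

(* e^(tau t) whenever tau^2 = -1. *)
Definition cis (tau : R[i]) (t : R) : R[i] := (cos t)%:C%C + tau * (sin t)%:C%C.

Lemma cos2_sin2_complex (t : R) : ((cos t)%:C%C : R[i]) ^+ 2 + (sin t)%:C%C ^+ 2 = 1.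
Proof.
rewrite -!rmorphXn -rmorphD -(rmorph1 (real_complex R)); congr (_ %:C)%C.
by have := sin2_cos2 t; rewrite /Rsqr !RmultE RplusE addrC.
Qed.

Lemma cisD (tau : R[i]) (s t : R) : tau ^+ 2 = -1 -> cis tau (s + t)%R = cis tau s * cis tau t.
Proof.
move=> tau2; have hc : cos (s + t)%R = cos s * cos t - sin s * sin t := cos_plus s t.
have hs : sin (s + t)%R = sin s * cos t + cos s * sin t := sin_plus s t.
rewrite /cis hc hs rmorphB rmorphD !rmorphM /=; ring: tau2.
Qed.

Lemma cis0 (tau : R[i]) : cis tau 0 = 1.
Proof. by rewrite /cis cos_0 sin_0 mulr0 addr0. Qed.

Lemma cis_nat (tau : R[i]) (t : R) (j : nat) : tau ^+ 2 = -1 ->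
  cis tau (INR j * t)%R = cis tau t ^+ j.
Proof.
move=> tau2; elim: j => [|j IHj]; first by rewrite mul0r cis0.
by rewrite INRE -natr1 -INRE mulrDl mul1r cisD // IHj exprSr.
Qed.

Lemma cisN (tau : R[i]) (t : R) : cis (- tau) t = cis tau (- t)%R.
Proof.
have hc : cos (- t)%R = cos t := cos_neg t.
have hs : sin (- t)%R = - sin t := sin_neg t.
by rewrite /cis hc hs rmorphN mulrN mulNr.
Qed.

Lemma cis_mulN (tau : R[i]) (t : R) : tau ^+ 2 = -1 -> cis tau t * cis (- tau) t = 1.
Proof. by move=> tau2; rewrite cisN -cisD // subrr cis0. Qed.

(** * Plane waves and the action of the Hessian on them *)

Lemma sum_shift (n : nat) (g : nat -> R[i]) : g n = g 0%N ->
  \sum_(j < n) g j.+1 = \sum_(j < n) g j.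
Proof.
case: n => [|n] gn; first by rewrite !big_ord0.
by rewrite big_ord_recr big_ord_recl /= gn addrC.
Qed.

Lemma expr_modulo (n j : nat) (eta : R[i]) : (0 < n)%N -> eta ^+ n = 1 ->
  eta ^+ Nat.modulo j n = eta ^+ j.
Proof.
move=> n0 etan; have n_neq0 : n <> 0%N by move=> n1; rewrite n1 in n0.
rewrite [in RHS](PeanoNat.Nat.div_mod j n n_neq0).
by rewrite exprD exprM etan expr1n mul1r.
Qed.

(* The plane wave with value eta^j (1, tau) at site j. *)
Definition wave (tau eta : R[i]) (l : nat) : R[i] :=
  eta ^+ l./2 * (if odd l then tau else 1).

Definition amplitude (n : nat) (w : nat -> R[i]) (tau eta : R[i]) : R[i] :=
  \sum_(j < n) eta ^+ j * (w (2 * j + 0)%N + tau * w (2 * j + 1)%N).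

Lemma wave0 (tau eta : R[i]) (j : nat) : wave tau eta (2 * j + 0)%N = eta ^+ j.
Proof. by rewrite /wave mul2n addn0 odd_double doubleK mulr1. Qed.

Lemma wave1 (tau eta : R[i]) (j : nat) : wave tau eta (2 * j + 1)%N = eta ^+ j * tau.
Proof. by rewrite /wave mul2n addn1 /= odd_double uphalf_double. Qed.

(** Plane waves with eta^n = 1 diagonalise the cyclic Laplacian, with eigenvalue (eta - 1)(eta^-1 -
    1). *)
Lemma sum_diff_wave (n : nat) (w : nat -> R[i]) (tau eta : R[i]) : (0 < n)%N -> eta ^+ n = 1 ->
  let f := wave tau eta in
  let dw j c := w (2 * Nat.modulo (j + 1) n + c)%N - w (2 * Nat.modulo j n + c)%N in
  let df j c := f (2 * Nat.modulo (j + 1) n + c)%N - f (2 * Nat.modulo j n + c)%N in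
  \sum_(j < n) (dw j 0%N * df j 0%N + dw j 1%N * df j 1%N)
  = (2 - eta - eta^-1) * amplitude n w tau eta.
Proof.
move=> n0 etan /=.
have eta0 : eta != 0.
  by apply: contra_eq_neq etan => ->; rewrite expr0n; case: n n0 => // k _; rewrite eq_sym oner_eq0.
pose z j := w (2 * Nat.modulo j n + 0)%N + tau * w (2 * Nat.modulo j n + 1)%N.
have zn : eta ^+ n * z n = eta ^+ 0 * z 0%N.
  by rewrite etan expr0 /z PeanoNat.Nat.Div0.mod_same PeanoNat.Nat.Div0.mod_0_l.
have ampE : amplitude n w tau eta = \sum_(j < n) eta ^+ j * z j.
  by apply: eq_bigr => j _; rewrite /z PeanoNat.Nat.mod_small //; apply/ltP.
(* The factor eta^-1 turns eta^j z_(j+1) into a shifted term, whose sum over the cycle is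
   unchanged. *)
transitivity (\sum_(j < n) (eta - 1) * (eta^-1 * (eta ^+ j.+1 * z j.+1) - eta ^+ j * z j)).
  apply: eq_bigr => j _; rewrite !wave0 !wave1 !expr_modulo // addn1 exprS /z.
  by field.
rewrite -mulr_sumr sumrB -mulr_sumr (sum_shift n (fun j => eta ^+ j * z j)) // -ampE.
by field.
Qed.

Lemma am_coord (n m : nat) (a : R) (j : nat) : (j < n)%N ->
  (ucoord n (am n m a) j 0 = a * cos (INR j * (INR m * zeta n))%R) *
  (ucoord n (am n m a) j 1 = a * sin (INR j * (INR m * zeta n))%R).
Proof.
move=> jn; rewrite /ucoord PeanoNat.Nat.mod_small; last exact/ltP.
rewrite /am mul2n addn0 addn1 /= !odd_double /= uphalf_double doubleK.
by rewrite !RmultE mulrA.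
Qed.

Lemma normsq_am (n m : nat) (a : R) (j : nat) : (j < n)%N -> normsq n (am n m a) j = a ^+ 2.
Proof.
move=> jn; rewrite /normsq !am_coord //.
have := sin2_cos2 (INR j * (INR m * zeta n)); rewrite /Rsqr !RmultE !RpowE !RplusE => h.
rewrite !exprMn -mulrDr -[RHS]mulr1; congr (_ * _); rewrite addrC !expr2. exact: h.
Qed.

(** The choice of frequency cancels V'(a^2) and leaves 4 sin(t/2)^2 with t = m zeta, so the Hessian
    at [am] depends on V only through V''(a^2). *)
Lemma omega_am (V : R -> R) (n m : nat) (a : R) :
  Derive V (a ^+ 2)%R + omega V n m a = 2 - 2 * cos (INR m * zeta n)%R.
Proof.
rewrite /omega RminusE RpowE addrC RpowE subrK RmultE RdivE RmultE.
set t := INR m * zeta n.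
have two : IZR 2 = 2 :> R by rewrite IZRposE INRE.
have four : IZR 4 = 4 :> R by rewrite IZRposE INRE.
have h : cos t = 1 - 2 * sin (t / 2)%R ^+ 2.
  have := cos_2a_sin (Rdiv t (IZR 2)).
  rewrite !RmultE RdivE RminusE two mulrCA mulfV ?mulr1; last by rewrite pnatr_eq0.
  by rewrite -mulrA expr2.
by rewrite h four two; ring.
Qed.

Lemma hess_wave (V : R -> R) (n m : nat) (a : R) (w : nat -> R[i]) (tau eta : R[i]) :
  (forall y, ex_derive V y) -> (forall y, ex_derive (Derive V) y) ->
  (0 < n)%N -> tau ^+ 2 = -1 -> eta ^+ n = 1 ->
  \sum_(k < 2 * n) \sum_(l < 2 * n)
    w k * (hess (Ham V n m a) (am n m a) k l)%:C%C * wave tau eta l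
  = (a ^+ 2 * Derive (Derive V) (a ^+ 2)%R)%:C%C
      * (amplitude n w tau eta
         + amplitude n w (- tau) (eta * cis tau (INR m * zeta n)%R ^+ 2))
    + (eta + eta^-1 - 2 * (cos (INR m * zeta n)%R)%:C%C) * amplitude n w tau eta.
Proof.
move=> dV ddV n0 tau2 etan.
transitivity (\sum_(j < n) \sum_(k < 2 * n) \sum_(l < 2 * n)
    w k * (hess_density V n m a (am n m a) (unit_vec k) (unit_vec l) j)%:C%C * wave tau eta l).
  rewrite [RHS]exchange_big; apply: eq_bigr => k _.
  rewrite [RHS]exchange_big; apply: eq_bigr => l _.
  by rewrite hess_Ham // rmorph_sum mulr_sumr mulr_suml.
under eq_bigr => j _ do rewrite hess_density_sum //.
rewrite sumrB sum_diff_wave //.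
set A := (a ^+ 2 * _)%:C%C; set t := INR m * zeta n.
(* With C, S the cosine and sine of j t, the coupling comes from 2 (C + tau S)(C w_j0 + S w_j1) =
   (w_j0 + tau w_j1) + (C + tau S)^2 (w_j0 - tau w_j1). *)
transitivity (\sum_(j < n) (A * (eta ^+ j * (w (2 * j + 0)%N + tau * w (2 * j + 1)%N) +
   (eta * cis tau t ^+ 2) ^+ j * (w (2 * j + 0)%N + - tau * w (2 * j + 1)%N))
   + (2 - 2 * (cos t)%:C%C) * (eta ^+ j * (w (2 * j + 0)%N + tau * w (2 * j + 1)%N)))
   - (2 - eta - eta^-1) * amplitude n w tau eta).
  congr (_ - _); apply: eq_bigr => j _.
  have jn := ltn_ord j.
  rewrite normsq_am // omega_am !am_coord // PeanoNat.Nat.mod_small; last exact/ltP.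
  rewrite wave0 wave1 exprMn exprAC -cis_nat // /cis -/t.
  have := cos2_sin2_complex (INR j * t).
  rewrite /A !RmultE !rmorphM /= rmorphB rmorphM.
  rewrite !(rmorph_nat _ 2) /=.
  move: (real_complex _ (cos (INR j * t)%R)) (real_complex _ (sin (INR j * t)%R)) => C S CS.
  have C2 : C ^+ 2 = 1 - S ^+ 2 by rewrite -CS addrK.
  ring: tau2 C2.
rewrite big_split /= -!mulr_sumr big_split /= -!/(amplitude _ _ _ _).
ring.
Qed.

(** * The eigenvector equation in terms of amplitudes *)

Lemma sum_even_odd (n : nat) (f : nat -> R[i]) :
  \sum_(k < 2 * n) f k = \sum_(j < n) (f (2 * j + 0)%N + f (2 * j + 1)%N).
Proof.
elim: n => [|n IHn]; first by rewrite muln0 !big_ord0.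
rewrite mulnS add2n !big_ord_recr /= IHn addrA addn0 addn1 //.
Qed.

(* The row vector v J, coordinatewise. *)
Definition apply_calJ (v : nat -> R[i]) (l : nat) : R[i] :=
  if odd l then - v l.-1 else v l.+1.

(** Each column of [calJ] has exactly one nonzero entry: -1 just above the diagonal or 1 just below
    it. *)
Lemma sum_calJ (n l : nat) (v : nat -> R[i]) (hl : (l < 2 * n)%N) :
  \sum_(k < 2 * n) v k * (calJ n k (Ordinal hl))%:C%C = apply_calJ v l.
Proof.
rewrite /apply_calJ; case: (boolP (odd l)) => ol.
  have l0 : (0 < l)%N by case: l ol {hl}.
  have hl1 : (l.-1 < 2 * n)%N by rewrite (leq_ltn_trans (leq_pred l)).
  rewrite (bigD1 (Ordinal hl1)) //= big1 => [|k neq_k]; rewrite !mxE /=.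
    rewrite prednK // eqxx andbT -oddS prednK // ol /=.
    by rewrite addr0 rmorphN rmorph1 mulrN mulr1.
  case: eqP => [lk|_]; last rewrite andbF.
    by case/eqP: neq_k; apply: val_inj; rewrite /= lk.
  case: eqP => [kl|_]; last by rewrite andbF mulr0.
  by rewrite kl /= ol /= mulr0.
have hl1 : (l.+1 < 2 * n)%N.
  rewrite ltn_neqAle hl andbT; apply: contraNneq ol => e.
  by rewrite -[odd l]negbK -oddS e mul2n odd_double.
rewrite (bigD1 (Ordinal hl1)) //= big1 => [|k neq_k]; rewrite !mxE /=.
  by rewrite ol /= eqxx mulr1 addr0.
case: (altP (@eqP _ (k : nat) l.+1)) => [kl|_]; last rewrite andbF.
  by case/eqP: neq_k; apply: val_inj; rewrite /= kl.
case: eqP => [lk|_]; last by rewrite andbF mulr0.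
have ok : odd k by move: ol; rewrite lk /= negbK.
by rewrite ok /= mulr0.
Qed.

(** Pair both sides of the eigenvector equation with [wave tau eta]. The left side is [hess_wave]
    for w = v J; on the right, tau^2 = -1 gives v_j0 + tau v_j1 = tau (w_j0 + tau w_j1). *)
Lemma eigen_wave (V : R -> R) (n m : nat) (a : R) (v : nat -> R[i]) (lam tau eta : R[i]) :
  (forall y, ex_derive V y) -> (forall y, ex_derive (Derive V) y) ->
  (0 < n)%N -> tau ^+ 2 = -1 -> eta ^+ n = 1 ->
  \row_(k < 2 * n) v k
    *m map_mx (fun x : R => x%:C%C) (calJ n *m hess_mx n (Ham V n m a) (am n m a))
  = lam *: \row_(k < 2 * n) v k ->
  let w := apply_calJ v in
  (a ^+ 2 * Derive (Derive V) (a ^+ 2)%R)%:C%C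
      * (amplitude n w tau eta
         + amplitude n w (- tau) (eta * cis tau (INR m * zeta n)%R ^+ 2))
    + (eta + eta^-1 - 2 * (cos (INR m * zeta n)%R)%:C%C) * amplitude n w tau eta
  = lam * tau * amplitude n w tau eta.
Proof.
move=> dV ddV n0 tau2 etan eig w.
rewrite -hess_wave //.
transitivity (\sum_(l < 2 * n) (lam *: \row_(k < 2 * n) v k) 0 l * wave tau eta l); last first.
  transitivity (\sum_(l < 2 * n) (lam * v l) * wave tau eta l).
    by apply: eq_bigr => l _; rewrite !mxE.
  rewrite (sum_even_odd n (fun l => lam * v l * wave tau eta l)) /amplitude mulr_sumr.
  apply: eq_bigr => j _; rewrite wave0 wave1 /w /apply_calJ.
  rewrite mul2n addn0 addn1 /= odd_double /=.
  ring: tau2.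
rewrite -eig exchange_big; apply: eq_bigr => l _.
rewrite -mulr_suml; congr (_ * _).
rewrite map_mxM mulmxA mxE; apply: eq_bigr => k _.
rewrite [in RHS]mxE [in RHS]mxE; congr (_ * _); last by rewrite mxE.
rewrite /w -(sum_calJ n k v (ltn_ord k)); apply: eq_bigr => i _.
by rewrite !mxE.
Qed.

(** * Recovering the vector from its amplitudes at roots of unity *)

Lemma amplitude_inj (n : nat) (w : nat -> R[i]) (tau omg e : R[i]) :
  n.-primitive_root omg -> e != 0 ->
  (forall k, (k < n)%N -> amplitude n w tau (omg ^+ k * e) = 0) ->
  forall j, (j < n)%N -> w (2 * j + 0)%N + tau * w (2 * j + 1)%N = 0.
Proof.
move=> prim e0 amp0 j jn.
pose p := \poly_(i < n) (w (2 * i + 0)%N + tau * w (2 * i + 1)%N).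
(* These n points are distinct because [omg] is primitive and [e] is nonzero, while [p] has at most
   n coefficients. *)
pose s := [seq omg ^+ k * e | k <- iota 0 n].
suff p0 : p = 0.
  have := coef_poly n (fun i => w (2 * i + 0)%N + tau * w (2 * i + 1)%N) j.
  by rewrite -/p p0 coef0 jn.
apply: (@roots_geq_poly_eq0 _ p s).
- apply/allP => x /mapP[k]; rewrite mem_iota => /andP[_ kn] ->; apply/rootP.
  rewrite horner_poly -[X in _ = X](amp0 k kn); apply: eq_bigr => i _; exact: mulrC.
- rewrite map_inj_in_uniq ?iota_uniq // => k l.
  rewrite !mem_iota => /andP[_ kn] /andP[_ ln] /(mulIf e0) /eqP.
  by rewrite (eq_prim_root_expr prim) !modn_small // => /eqP.
- by rewrite size_map size_iota size_poly.
Qed.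

Lemma cis_add_inv (tau : R[i]) (t : R) : tau ^+ 2 = -1 ->
  cis tau t + (cis tau t)^-1 = (2 * cos t)%:C%C.
Proof.
move=> tau2; rewrite (mulr1_eq (cis_mulN tau t tau2)) /cis rmorphM /=.
rewrite !(rmorph_nat _ 2) /=; ring.
Qed.

Lemma cis_zeta_expn (n : nat) (tau : R[i]) : (0 < n)%N -> tau ^+ 2 = -1 ->
  cis tau (zeta n) ^+ n = 1.
Proof.
move=> n0 tau2; rewrite -cis_nat //.
have -> : INR n * zeta n = Rmult (IZR 2) PI.
  exact: INR_mul_zeta.
by rewrite /cis cos_2PI sin_2PI mulr0 addr0.
Qed.

Lemma prim_root_cis (n : nat) : (3 <= n)%N -> n.-primitive_root (cis 'i%C (zeta n)).
Proof.
move=> n3; have n0 : (0 < n)%N by apply: leq_trans n3.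
apply/andP; split => //; apply/forallP => k; apply/eqP; rewrite unity_rootE.
case: (eqVneq k.+1 n) => [->|kn]; first by rewrite cis_zeta_expn ?eqxx // sqr_i.
(* Real parts of omg^(k+1) = 1 would give cos((k+1) zeta) = 1 with 0 < k+1 < n. *)
apply/negbTE/eqP; rewrite -cis_nat ?sqr_i // => /(congr1 (@complex.Re _)) h.
apply: (cos_zeta_neq1 n k.+1) => //; first by apply/andP; split=> //; rewrite ltn_neqAle kn ltn_ord.
by move: h; rewrite /cis /= !mul0r mulr0 subrr addr0.
Qed.

Local Open Scope R_scope.

(** * The 2x2 systems and the spectrum *)

Lemma real_eigenvalue (alpha x y : R) (p q lam : R[i]) :
  (alpha%:C%C * (p + q) + x%:C%C * p = lam * 'i%C * p)%R ->
  (alpha%:C%C * (q + p) + y%:C%C * q = lam * - 'i%C * q)%R ->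
  ((p != 0) || (q != 0))%R -> 0 <= (x + y) * (x + y + 4 * alpha) ->
  complex.Re lam = 0.
Proof.
move=> hp hq pq disc.
(* The determinant of the system in (p, q); elimination shows that it annihilates both unknowns,
   hence vanishes. *)
pose D := ((alpha%:C%C + x%:C%C - lam * 'i%C) * (alpha%:C%C + y%:C%C + lam * 'i%C)
  - alpha%:C%C ^+ 2)%R.
have hp' : ((alpha%:C%C + x%:C%C - lam * 'i%C) * p = - (alpha%:C%C * q))%R.
  by apply/eqP; rewrite -subr_eq0 opprK mulrBl -hp; apply/eqP; ring.
have hq' : ((alpha%:C%C + y%:C%C + lam * 'i%C) * q = - (alpha%:C%C * p))%R.
  have : (lam * 'i%C * q = - (lam * - 'i%C * q))%R by ring.
  by rewrite -hq mulrDl => ->; ring.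
have Dp : (D * p = 0)%R.
  rewrite /D mulrBl mulrAC hp' mulNr -mulrA [(q * _)%R]mulrC hq'; ring.
have Dq : (D * q = 0)%R.
  rewrite /D mulrBl -mulrA hq' mulrN mulrCA hp'; ring.
have D0 : (D = 0)%R.
  case/orP: pq => [p0|q0]; first by apply: (mulIf p0); rewrite mul0r.
  by apply: (mulIf q0); rewrite mul0r.
(* With lam = r + i s one has lam i = -s + i r, so the real and imaginary parts of D = 0 are the
   equations of [real_quadratic]. *)
clear -D0 disc; case: lam @D D0 => r s D.
rewrite /D expr2 => /eqP; rewrite eq_complex /= => /andP[/eqP hre /eqP him].
apply: (real_quadratic alpha x y r s disc).
- rewrite !(RmultE, RplusE, RminusE, RpowE) -[RHS]hre; ring.
- rewrite !(RmultE, RplusE, RminusE) -[RHS]him; ring.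
Qed.

Theorem theorem2 (n m : nat) (a : R) (V : R -> R) :
  (3 <= n)%nat ->
  (1 <= m)%nat ->
  ((4 * m < n)%nat \/ ((n < 4 * m)%nat /\ (2 * m <= n)%nat)) ->
  0 < a ->
  (forall (k : nat) (x : R), ex_derive_n V k x) ->
  Derive_n V 2 (a ^ 2) <> 0 ->
  (sigma_m V n m a < 0 \/ (0 < sigma_m V n m a /\ phi1 V n m a < 1)) ->
  only_imaginary_eigenvalues (calJ n *m hess_mx n (Ham V n m a) (am n m a))%R.
Proof.
move=> n3 _ hm a0 smooth _ hsigma lam /eigenvalueP[u eig u0].
have n0 : (0 < n)%N by apply: leq_trans n3.
have dV y : ex_derive V y := smooth 1%N y.
have ddV y : ex_derive (Derive V) y := smooth 2%N y.
set i : R[i] := 'i%C.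
have i2 : (i ^+ 2 = -1)%R by rewrite sqr_i.
have iN2 : ((- i) ^+ 2 = -1)%R by rewrite sqrrN.
set t := INR m * zeta n; set omg := cis i (zeta n).
(* Extends the row vector [u] to all of nat, with value 0 beyond 2n. *)
pose v k := (\sum_(l < 2 * n | l == k :> nat) u 0 l)%R.
have uE : u = (\row_(k < 2 * n) v k)%R.
  apply/rowP => k; rewrite mxE /v (bigD1 k) //= big1 ?addr0 // => l /andP[/eqP lk].
  by case/eqP; apply: val_inj.
rewrite uE in eig u0; pose w := apply_calJ v.
(* For tau = -i and tau = i these are e^(i (k - m) zeta) and e^(i (k + m) zeta). *)
pose eta k tau := (omg ^+ k * cis tau t)%R.
have cisn tau : (tau ^+ 2 = -1 -> cis tau t ^+ n = 1)%R.
  by move=> tau2; rewrite /t RmultE cis_nat // -exprM mulnC exprM cis_zeta_expn // expr1n.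
have omgn : (omg ^+ n = 1)%R by apply: cis_zeta_expn.
have etan k tau : (tau ^+ 2 = -1 -> eta k tau ^+ n = 1)%R.
  by move=> tau2; rewrite exprMn -exprM mulnC exprM omgn expr1n mul1r cisn.
have cis_neq0 tau : (tau ^+ 2 = -1 -> cis tau t != 0)%R.
  move=> tau2; apply/eqP => e0; move: (cis_mulN tau t tau2); rewrite e0 mul0r => /eqP.
  by rewrite eq_sym oner_eq0.
(* The coupling swaps the two frequencies of index [k], so their two amplitudes form a closed
   system. *)
have etaE k tau : (tau ^+ 2 = -1 -> eta k tau * cis (- tau) t ^+ 2 = eta k (- tau))%R.
  by move=> tau2; rewrite /eta expr2 -mulrA [(cis tau t * _)%R]mulrA cis_mulN // mul1r.
(* If all amplitudes vanished, w_j0 + i w_j1 and w_j0 - i w_j1 would be 0 at every site, and the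
   eigenvector with them. *)
have [k kn nz] : exists2 k, (k < n)%N &
    ((amplitude n w i (eta k (- i)) != 0) || (amplitude n w (- i) (eta k i) != 0))%R.
  case: (boolP [exists k : 'I_n, (amplitude n w i (eta k (- i)) != 0)
       || (amplitude n w (- i) (eta k i) != 0)])%R => [/existsP[k hk]|].
    by exists (k : nat).
  rewrite negb_exists => /forallP all0; case/eqP: u0.
  have amp0 k : (k < n)%N ->
    (amplitude n w i (eta k (- i)) = 0 /\ amplitude n w (- i) (eta k i) = 0)%R.
    by move=> kn; have := all0 (Ordinal kn); rewrite negb_or !negbK => /andP[/eqP ? /eqP ?].
  have prim := prim_root_cis n n3.
  have w1 := amplitude_inj n w i omg _ prim (cis_neq0 _ iN2) (fun k kn => (amp0 k kn).1).
  have w2 := amplitude_inj n w (- i)%R omg _ prim (cis_neq0 _ i2) (fun k kn => (amp0 k kn).2).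
  have v0 j : (j < n)%N -> (v (2 * j)%N = 0 /\ v (2 * j + 1)%N = 0)%R.
    move=> jn; have := w1 j jn; have := w2 j jn.
    rewrite /w /apply_calJ mul2n addn0 addn1 /= odd_double /=.
    move: (v _) (v _) => p q hm1 hp1.
    have two0 : (2 != 0 :> R[i])%R by rewrite pnatr_eq0.
    have i0 : (i != 0)%R.
      by apply: contra_eq_neq i2 => ->; rewrite expr0n eq_sym oppr_eq0 oner_eq0.
    split.
      by apply: (mulfI (mulf_neq0 two0 i0)); rewrite mulr0 -(subrr 0%R) -{1}hm1 -hp1; ring.
    by apply: (mulfI two0); rewrite mulr0 -(addr0 0%R) -{1}hm1 -hp1; ring.
  apply/rowP => k; rewrite !mxE -(odd_double_half k) addnC -mul2n.
  have kn : (k./2 < n)%N by rewrite ltn_half_double -mul2n.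
  by case: (odd k) (v0 _ kn) => -[] //; rewrite addn0.
(* The diagonal coefficient eta + eta^-1 - 2 cos t at eta = e^(i s), which is real. *)
pose x s := 2 * cos s - 2 * cos t.
have xE tau s : (tau ^+ 2 = -1 ->
    cis tau s + (cis tau s)^-1 - 2 * (cos t)%:C%C = (x s)%:C%C)%R.
  move=> tau2; rewrite cis_add_inv // /x RminusE !RmultE IZRposE INRE rmorphB !rmorphM /=.
  by rewrite !(rmorph_nat _ 2).
have eta_i : eta k i = cis i (INR k * zeta n + t) by rewrite /eta -cis_nat // -cisD.
have eta_Ni : eta k (- i)%R = cis i (INR k * zeta n - t).
  by rewrite /eta -cis_nat // cisN -cisD.
have xE1 := xE i (INR k * zeta n - t) i2; rewrite -eta_Ni in xE1.
have xE2 := xE i (INR k * zeta n + t) i2; rewrite -eta_i in xE2.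
have := discriminant_ge0 V n m a k n3 hm a0 hsigma kn.
have E1 := eigen_wave V n m a v lam i (eta k (- i)%R) dV ddV n0 i2 (etan _ _ iN2) eig.
have E2 := eigen_wave V n m a v lam (- i)%R (eta k i) dV ddV n0 iN2 (etan _ _ i2) eig.
rewrite /= -/w -/t in E1 E2.
have etaE1 : (eta k (- i) * cis i t ^+ 2 = eta k i)%R by have := etaE k _ iN2; rewrite opprK.
rewrite etaE1 xE1 in E1; rewrite opprK etaE // xE2 in E2.
move=> disc; apply: real_eigenvalue E1 E2 nz _; rewrite -!RpowE; exact: disc.
Qed.
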